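(* Let $\mathbb{F}$ be a field of characteristic $2$, let $((\mathfrak{g},[2]_{\mathfrak{g}}),\mathscr{D}_{\mathfrak{g}})$ be a ResLieDer pair and $((\mathfrak{h},[2]_{\mathfrak{h}}),\mathscr{D}_{\mathfrak{h}})$ a strongly abelian ResLieDer pair over $\mathbb{F}$. The central extensions of $((\mathfrak{g},[2]_{\mathfrak{g}}),\mathscr{D}_{\mathfrak{g}})$ by $((\mathfrak{h},[2]_{\mathfrak{h}}),\mathscr{D}_{\mathfrak{h}})$ are classified by the second cohomology group $H^2_{\mathrm{ResLD}}(\mathfrak{g};\mathfrak{h})$ of $((\mathfrak{g},[2]_{\mathfrak{g}}),\mathscr{D}_{\mathfrak{g}})$ with values in the trivial representation $(\mathfrak{h},0,\mathscr{D}_{\mathfrak{h}})$; that is, assigning to a central extension the class of the 2-cocycle $((\psi,\varsigma),\tau)$ obtained from any section induces a bijection between isomorphism classes of central extensions and $H^2_{\mathrm{ResLD}}(\mathfrak{g};\mathfrak{h})$.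
   Context: Over a field $\mathbb{F}$ of characteristic $2$: a restricted Lie algebra $(\mathfrak{g},[2])$ is a Lie algebra with a map $x\mapsto x^{[2]}$ such that $[x^{[2]},y]_{\mathfrak{g}}=[x,[x,y]_{\mathfrak{g}}]_{\mathfrak{g}}$, $(ax)^{[2]}=a^2x^{[2]}$, $(x+y)^{[2]}=x^{[2]}+y^{[2]}+[x,y]_{\mathfrak{g}}$. A ResLieDer pair $((\mathfrak{g},[2]),\mathscr{D})$ is a restricted Lie algebra with a linear derivation $\mathscr{D}$ satisfying $\mathscr{D}(x^{[2]})=[x,\mathscr{D}(x)]_{\mathfrak{g}}$; it is strongly abelian if its bracket and its map $[2]$ are identically zero. A morphism of ResLieDer pairs is a Lie algebra morphism commuting with the maps $[2]$ and with the derivations. A central extension of $((\mathfrak{g},[2]_{\mathfrak{g}}),\mathscr{D}_{\mathfrak{g}})$ by $((\mathfrak{h},[2]_{\mathfrak{h}}),\mathscr{D}_{\mathfrak{h}})$ is a ResLieDer pair $((\hat{\mathfrak{g}},[2]_{\hat{\mathfrak{g}}}),\mathscr{D}_{\hat{\mathfrak{g}}})$ with an exact sequence $0\to\mathfrak{h}\xrightarrow{i}\hat{\mathfrak{g}}\xrightarrow{\theta}\mathfrak{g}\to0$ of ResLieDer pair morphisms such that $[\mathfrak{h},\hat{\mathfrak{g}}]_{\hat{\mathfrak{g}}}=0$; $\mathfrak{h}$ is identified with $i(\mathfrak{h})$. Two central extensions $(\hat{\mathfrak{g}}_1,i_1,\theta_1)$, $(\hat{\mathfrak{g}}_2,i_2,\theta_2)$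 are isomorphic if there is a ResLieDer pair morphism $\pi:\hat{\mathfrak{g}}_1\to\hat{\mathfrak{g}}_2$ with $\pi\circ i_1=i_2$ and $\theta_2\circ\pi=\theta_1$. A section is a linear map $s:\mathfrak{g}\to\hat{\mathfrak{g}}$ with $\theta\circ s=\mathrm{Id}$; it gives maps into $\mathfrak{h}$: $\psi(x,y)=[s(x),s(y)]_{\hat{\mathfrak{g}}}+s([x,y]_{\mathfrak{g}})$, $\varsigma(x)=s(x)^{[2]_{\hat{\mathfrak{g}}}}+s(x^{[2]_{\mathfrak{g}}})$, $\tau(x)=\mathscr{D}_{\hat{\mathfrak{g}}}(s(x))+s(\mathscr{D}_{\mathfrak{g}}(x))$. Cohomology with values in the trivial representation $(\mathfrak{h},0,\mathscr{D}_{\mathfrak{h}})$: a 2-cochain is $((\psi,\varsigma),\tau)$ with $\psi:\wedge^2\mathfrak{g}\to\mathfrak{h}$ alternating bilinear, $\varsigma:\mathfrak{g}\to\mathfrak{h}$ satisfying $\varsigma(ax)=a^2\varsigma(x)$ and $\varsigma(x+y)=\varsigma(x)+\varsigma(y)+\psi(x,y)$, and $\tau:\mathfrak{g}\to\mathfrak{h}$ linear. It is a 2-cocycle (element of $Z^2_{\mathrm{ResLD}}(\mathfrak{g};\mathfrak{h})$) if for all $x,y,z$: $\psi(x,[y,z]_{\mathfrak{g}})+\psi(y,[z,x]_{\mathfrak{g}})+\psi(z,[x,y]_{\mathfrak{g}})=0$; $\psi(x^{[2]_{\mathfrak{g}}},y)+\psi([x,y]_{\mathfrak{g}},x)=0$;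 $\tau([x,y]_{\mathfrak{g}})+\mathscr{D}_{\mathfrak{h}}(\psi(x,y))+\psi(\mathscr{D}_{\mathfrak{g}}(x),y)+\psi(x,\mathscr{D}_{\mathfrak{g}}(y))=0$; $\tau(x^{[2]_{\mathfrak{g}}})+\mathscr{D}_{\mathfrak{h}}(\varsigma(x))+\psi(x,\mathscr{D}_{\mathfrak{g}}(x))=0$. The 2-coboundaries $B^2_{\mathrm{ResLD}}(\mathfrak{g};\mathfrak{h})$ are the $((d^1\kappa,\omega_\kappa),\delta\kappa)$ for $\kappa:\mathfrak{g}\to\mathfrak{h}$ linear, where $d^1\kappa(x,y)=\kappa([x,y]_{\mathfrak{g}})$, $\omega_\kappa(x)=\kappa(x^{[2]_{\mathfrak{g}}})$, $\delta\kappa(x)=\mathscr{D}_{\mathfrak{h}}(\kappa(x))+\kappa(\mathscr{D}_{\mathfrak{g}}(x))$. $H^2_{\mathrm{ResLD}}=Z^2_{\mathrm{ResLD}}/B^2_{\mathrm{ResLD}}$. *)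

(* Defs.v *)
From HB Require Import structures.
From mathcomp Require Import all_boot all_algebra.
From mathcomp Require Import boolp functions.

Set Implicit Arguments.
Unset Strict Implicit.
Unset Printing Implicit Defensive.

Import GRing.Theory.
Local Open Scope ring_scope.

(* The identities below are those of characteristic 2, where signs are        *)
(* irrelevant; the hypothesis 2 \in [pchar F] is left to the theorems.        *)

Definition bilinear_map (F : fieldType) (U V : lmodType F) (f : U -> U -> V) :=
  (forall x, linear (f x)) /\ (forall y, linear (f^~ y)).

HB.mixin Record isLieAlgebra (F : fieldType) L of GRing.Lmodule F L := {
  lie : L -> L -> L;
  lie_bilinear : bilinear_map lie;
  liexx : forall x, lie x x = 0;
  lie_jacobi : forall x y z,
    lie x (lie y z) + lie y (lie z x) + lie z (lie x y) = 0
}.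

#[short(type="lieType")]
HB.structure Definition LieAlgebra (F : fieldType) :=
  {L of isLieAlgebra F L & GRing.Lmodule F L}.

HB.mixin Record isRestricted2 (F : fieldType) L of LieAlgebra F L := {
  pow2 : L -> L;
  lie_pow2 : forall x y : L, lie (pow2 x) y = lie x (lie x y);
  pow2Z : forall (a : F) (x : L), pow2 (a *: x) = a ^+ 2 *: pow2 x;
  pow2D : forall x y : L, pow2 (x + y) = pow2 x + pow2 y + lie x y
}.

#[short(type="resLieType")]
HB.structure Definition ResLie (F : fieldType) :=
  {L of isRestricted2 F L & LieAlgebra F L}.

HB.mixin Record hasRestrictedDerivation (F : fieldType) L of ResLie F L := {
  der : L -> L;
  der_linear : linear der;
  der_lie : forall x y : L, der (lie x y) = lie (der x) y + lie x (der y);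
  der_pow2 : forall x : L, der (pow2 x) = lie x (der x)
}.

#[short(type="resLieDerType")]
HB.structure Definition ResLieDer (F : fieldType) :=
  {L of hasRestrictedDerivation F L & ResLie F L}.

Definition strongly_abelian (F : fieldType) (h : resLieDerType F) : Prop :=
  (forall x y : h, lie x y = 0) /\ (forall x : h, pow2 x = 0).

Definition pair_morphism (F : fieldType) (g h : resLieDerType F)
    (f : {linear g -> h}) : Prop :=
  [/\ {morph f : x y / lie x y}, {morph f : x / pow2 x} &
      {morph f : x / der x}].

Record central_ext (F : fieldType) (g h : resLieDerType F) := CentralExt {
  ext_pair :> resLieDerType F;
  ext_inc : {linear h -> ext_pair};
  ext_proj : {linear ext_pair -> g};
  ext_inc_morph : pair_morphism ext_inc;
  ext_proj_morph : pair_morphism ext_proj;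
  ext_inc_inj : injective ext_inc;
  ext_exact : forall e, ext_proj e = 0 <-> exists a, ext_inc a = e;
  ext_proj_surj : forall x, exists e, ext_proj e = x;
  ext_central : forall a e, lie (ext_inc a) e = 0
}.

Section Extensions.
Variables (F : fieldType) (g h : resLieDerType F).

Definition ext_iso (E1 E2 : central_ext g h) : Prop :=
  exists f : {linear E1 -> E2},
    [/\ pair_morphism f, forall a, f (ext_inc E1 a) = ext_inc E2 a &
        forall e, ext_proj E2 (f e) = ext_proj E1 e].

Lemma ext_iso_refl E : ext_iso E E.
Proof. by exists (GRing.Linear.clone _ _ _ _ (@idfun E) _). Qed.

Lemma ext_iso_trans E1 E2 E3 : ext_iso E1 E2 -> ext_iso E2 E3 -> ext_iso E1 E3.
Proof.
move=> [f [[fl fp fd] fi fpr]] [k [[kl kp kd] ki kpr]].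
exists (GRing.Linear.clone _ _ _ _ (k \o f) _); split=> [|a|e] /=.
- split=> [x y|x|x] /=; first by rewrite fl kl.
    by rewrite fp kp.
  by rewrite fd kd.
- by rewrite fi ki.
- by rewrite kpr fpr.
Qed.

Lemma ext_iso_sym E1 E2 : ext_iso E1 E2 -> ext_iso E2 E1.
Proof.
move=> [f [[fl fp fd] fi fpr]].
have f_inj : injective f.
  move=> x y fxy; apply/eqP; rewrite -subr_eq0; apply/eqP.
  have fxy0 : f (x - y) = 0 by rewrite linearB /= fxy subrr.
  have [a ha] : exists a, ext_inc E1 a = x - y.
    by apply/ext_exact; rewrite -fpr fxy0 raddf0.
  rewrite -ha; suff -> : a = 0 by rewrite raddf0.
  by apply: (@ext_inc_inj _ _ _ E2); rewrite -fi ha fxy0 raddf0.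
have f_surj e : exists e', f e' = e.
  have [e1 he1] := ext_proj_surj E1 (ext_proj E2 e).
  have [a ha] : exists a, ext_inc E2 a = e - f e1.
    by apply/ext_exact; rewrite linearB /= fpr he1 subrr.
  by exists (e1 + ext_inc E1 a); rewrite linearD /= fi ha addrC subrK.
have [k fk] := choice f_surj.
have klin : linear k by move=> a x y; apply: f_inj; rewrite linearP !fk.
pose kl : {linear E2 -> E1} :=
  HB.pack k (GRing.isLinear.Build F E2 E1 *:%R k klin).
exists kl; split=> [|a|e] /=.
- split=> [x y|x|x] /=; apply: f_inj; first by rewrite fl !fk.
    by rewrite fp !fk.
  by rewrite fd !fk.
- by apply: f_inj; rewrite fk fi.
- by rewrite -fpr fk.
Qed.

(* An isomorphism class is represented by its membership predicate. *)
Definition ext_class : Type :=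
  {C : central_ext g h -> Prop | exists E, C = ext_iso E}.

Definition class_of_ext (E : central_ext g h) : ext_class :=
  exist _ (ext_iso E) (ex_intro _ E erefl).

(* A cochain ((psi, vs), tau) with values in the trivial representation: only *)
(* the module h and its derivation enter. Sums are pointwise.                 *)
Definition precochain : Type := ((g -> g -> h) * (g -> h) * (g -> h))%type.
HB.instance Definition _ := GRing.Lmodule.on precochain.

Definition is_2cochain (c : precochain) : Prop :=
  let: (psi, vs, tau) := c in
  [/\ bilinear_map psi /\ (forall x, psi x x = 0),
      forall (a : F) x, vs (a *: x) = a ^+ 2 *: vs x,
      forall x y, vs (x + y) = vs x + vs y + psi x y &
      linear tau].

Definition is_2cocycle (c : precochain) : Prop :=
  is_2cochain c /\
  let: (psi, vs, tau) := c in
  [/\ forall x y z,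
        psi x (lie y z) + psi y (lie z x) + psi z (lie x y) = 0,
      forall x y, psi (pow2 x) y + psi (lie x y) x = 0,
      forall x y, tau (lie x y) + der (psi x y)
                    + psi (der x) y + psi x (der y) = 0 &
      forall x, tau (pow2 x) + der (vs x) + psi x (der x) = 0].

Definition coboundary (k : g -> h) : precochain :=
  (fun x y => k (lie x y), fun x => k (pow2 x),
   fun x => der (k x) + k (der x)).

Definition Z2_pred : {pred precochain} := fun c => `[< is_2cocycle c >].

Lemma comb_add (a : F) (x y x' y' : h) :
  (a *: x + y) + (a *: x' + y') = a *: (x + x') + (y + y').
Proof. by rewrite scalerDr addrACA. Qed.

Lemma Z2_closed : GRing.subsemimod_closed Z2_pred.
Proof.
have hder a (x y : h) : der (a *: x + y) = a *: der x + der y.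
  exact: der_linear.
have der0 : der (0 : h) = 0.
  by have := hder (-1) 0 0; rewrite scaleN1r addr0 oppr0 scaleN1r addNr.
have Z0 : 0 \in Z2_pred.
  apply/asboolP; split=> /=; split=> //.
  - by split=> //; split=> x a y z /=; rewrite scaler0 addr0.
  - by move=> a x /=; rewrite scaler0.
  - by move=> x y; rewrite !addr0.
  - by move=> a x y /=; rewrite scaler0 addr0.
  - by move=> x y z; rewrite !addr0.
  - by move=> x y; rewrite !addr0.
  - by move=> x y; rewrite der0 !addr0.
  - by move=> x; rewrite der0 !addr0.
have ZP a : {in Z2_pred &, forall c d, a *: c + d \in Z2_pred}.
  move=> [[p v] t] [[p' v'] t'] /asboolP[[[[pl pr] pa] vZ vD tl] [c1 c2 c3 c4]].
  move=> /asboolP[[[[pl' pr'] pa'] vZ' vD' tl'] [d1 d2 d3 d4]].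
  have comb b u (x y x' y' : h) : b *: (u *: x + y) + (u *: x' + y') =
      u *: (b *: x + x') + (b *: y + y').
    by rewrite scalerDr !scalerA (mulrC b) -scalerA addrACA -scalerDr.
  apply/asboolP; split=> /=; split.
  - split; last by move=> x; rewrite !fctE pa pa' scaler0 addr0.
    split=> x b y z; rewrite !fctE.
      by rewrite (pl x b) (pl' x b) comb.
    by have /= -> := pr x b y z; have /= -> := pr' x b y z; rewrite comb.
  - move=> b x; rewrite !fctE vZ vZ' [in RHS]scalerDr; congr (_ + _).
    by rewrite !scalerA mulrC.
  - by move=> x y; rewrite !fctE vD vD' !comb_add.
  - by move=> b x y; rewrite !fctE tl tl' comb.
  - by move=> x y z; rewrite !fctE !comb_add c1 d1 scaler0 addr0.
  - by move=> x y; rewrite !fctE !comb_add c2 d2 scaler0 addr0.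
  - by move=> x y; rewrite !fctE hder !comb_add c3 d3 scaler0 addr0.
  - by move=> x; rewrite !fctE hder !comb_add c4 d4 scaler0 addr0.
split; first split=> // c d cZ dZ; first by rewrite -[c]scale1r; exact: ZP.
by move=> a c cZ; rewrite -[_ *: _]addr0; exact: ZP.
Qed.
HB.instance Definition _ := GRing.isSubmodClosed.Build F precochain Z2_pred
  Z2_closed.

Record Z2 : predArgType := MkZ2 { Z2val :> precochain; _ : Z2val \in Z2_pred }.
HB.instance Definition _ := [isSub for Z2val].
HB.instance Definition _ := [Choice of Z2 by <:].
HB.instance Definition _ := [SubChoice_isSubLmodule of Z2 by <:].

Definition B2 : {pred Z2} :=
  fun c => `[< exists k : {linear g -> h}, val c = coboundary k >].

Lemma B2_closed : zmod_closed B2.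
Proof.
have derB (x y : h) : der (x - y) = der x - der y.
  by have := der_linear (-1) y x; rewrite !scaleN1r !(addrC (- _)).
split=> [|c d /asboolP[k ck] /asboolP[l dl]]; apply/asboolP.
  exists (GRing.Linear.clone _ _ _ _ (\0 : g -> h) _).
  have der0 : der (0 : h) = 0 by rewrite -(subrr (0 : h)) derB !subrr.
  congr (_, _, _); apply/funext => x //=.
  by rewrite der0 addr0.
exists (GRing.Linear.clone _ _ _ _ (k \- l) _).
rewrite raddfB /= ck dl; congr (_, _, _); apply/funext => x //=.
by rewrite !fctE derB opprD addrACA.
Qed.
HB.instance Definition _ := GRing.isZmodClosed.Build Z2 B2 B2_closed.

Lemma coboundary_cocycle (k : {linear g -> h}) :
  2 \in [pchar F] -> is_2cocycle (coboundary k).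
Proof.
move=> char2.
have addxx (x : h) : x + x = 0.
  by rewrite -mulr2n -scaler_nat (pcharf0 char2) scale0r.
have [gl gr] : bilinear_map (@lie F g) := lie_bilinear.
have hder a (x y : h) : der (a *: x + y) = a *: der x + der y.
  exact: der_linear.
have lieC (x y : g) : k (lie x y) = k (lie y x).
  suff e : k (lie x y) + k (lie y x) = 0.
    by rewrite -[LHS]addr0 -(addxx (k (lie y x))) addrA e add0r.
  have lD z : lie z (x + y) = lie z x + lie z y.
    by have := gl z 1 x y; rewrite !scale1r.
  have := gr (x + y) 1 x y; rewrite /= !scale1r !lD !liexx add0r addr0.
  have := liexx (x + y); rewrite lD => -> /esym/(congr1 k).
  by rewrite linearD linear0.
split; split=> /=.
- split=> [|x]; last by rewrite liexx linear0.
  by split=> x a y z /=; rewrite ?(gl x) -?linearP //; have /= -> := gr x a y z.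
- by move=> a x; rewrite pow2Z linearZ.
- by move=> x y; rewrite pow2D !linearD.
- move=> a x y; rewrite linearP hder (der_linear (a : F)) linearP.
  by rewrite scalerDr addrACA.
- by move=> x y z; rewrite -!linearD lie_jacobi linear0.
- by move=> x y; rewrite lie_pow2 [X in _ + X]lieC addxx.
- move=> x y; rewrite der_lie linearD.
  set c := der _; set a := k _; set b := k _.
  by rewrite (addrC c) -(addrA (a + b)) addxx addr0 -(addrA (a + b)) addxx.
- move=> x; rewrite der_pow2; set c := der _; set a := k _.
  by rewrite (addrC c) -(addrA a) addxx addr0 addxx.
Qed.

Definition H2 : Type := Quotient.quot B2.
HB.instance Definition _ := GRing.Zmodule.on H2.

Definition H2_class (c : Z2) : H2 := (\pi_(Quotient.quot B2) c)%qT.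

Definition is_section (E : central_ext g h) (s : {linear g -> E}) : Prop :=
  forall x, ext_proj E (s x) = x.

(* The defining formulas of (psi, vs, tau), read in E through ext_inc. *)
Definition section_cochain (E : central_ext g h) (s : {linear g -> E})
    (c : precochain) : Prop :=
  let: (psi, vs, tau) := c in
  [/\ forall x y, ext_inc E (psi x y) = lie (s x) (s y) + s (lie x y),
      forall x, ext_inc E (vs x) = pow2 (s x) + s (pow2 x) &
      forall x, ext_inc E (tau x) = der (s x) + s (der x)].

End Extensions.

(* Main.v *)
Require Import Defs.
From HB Require Import structures.
From mathcomp Require Import all_boot all_algebra.
From mathcomp Require Import boolp classical_sets.
Set Implicit Arguments.
Unset Strict Implicit.
Unset Printing Implicit Defensive.

Import GRing.Theory.
Local Open Scope ring_scope.

(** A central extension [E] of [g] by [h] is, as a vector space, a direct sum of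
    [h] and [g] once a linear section [s] of [ext_proj E] is chosen; such a
    section exists in any dimension, because the kernel of a linear map has a
    complement ([linear_right_inverse], by Zorn's lemma). Since the image of [h]
    is central, and its elements have zero square because [h] is strongly
    abelian, the bracket, the square and the derivation of [E] are recovered
    from those of [g] and [h] and the three defects of [s], that is, its cochain
    [((psi, vs), tau)]. The axioms of [E] evaluated on the lifts [s x] are
    the cocycle identities ([section_cochain_cocycle]). Two sections
    differ by a linear map [k : g -> h], and their cochains by the coboundary of
    [k] ([sections_differ], [section_cochain_shift]), so the cohomology class
    depends only on [E]; an isomorphism carries sections to sections with the
    same cochain ([ext_iso_section_cochain]), so it depends only on the
    isomorphism class of [E].

    Conversely, a cocycle [c] twists the operations of [h * g] into an extension
    [twisted_ext] whose evident section has cochain [c]. Every extension having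
    a section with cochain [c] is isomorphic to it ([twisted_ext_iso]). This
    gives the inverse map: if the class of [E] is that of [c], then shifting a
    section of [E] by a suitable [k] gives a section with cochain [c]
    ([section_shift]), hence an isomorphism from the twisted sum to [E]. *)

(** * Linear right inverses *)

Section LinearSection.
Variables (F : fieldType) (U V : lmodType F) (f : {linear U -> V}).

(** A subset closed under linear combinations on which [f] vanishes only at 0,
    that is, a subspace meeting the kernel of [f] trivially; the empty set is
    also accepted, so that the union of the empty chain qualifies. *)
Definition kernel_free (W : set U) : Prop :=
  (forall a x y, W x -> W y -> W (a *: x + y)) /\
  (forall x, W x -> f x = 0 -> x = 0).

Lemma exists_maximal_kernel_free :
  exists W, kernel_free W /\ forall W', (W `<` W')%classic -> ~ kernel_free W'.
Proof.
apply: Zorn_bigcup => C CP Ctot; split; last first.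
  by move=> x [W CW Wx]; apply: (CP W CW).2.
move=> a x y [W1 C1 W1x] [W2 C2 W2y].
have [le12|le21] := Ctot _ _ C1 C2.
- by exists W2 => //; apply: (CP W2 C2).1 => //; apply: le12.
- by exists W1 => //; apply: (CP W1 C1).1 => //; apply: le21.
Qed.

(** A maximal kernel-free subspace is a complement of the kernel: a vector
    whose image is not attained on it could be adjoined to it. *)
Lemma kernel_complement : (forall y, exists x, f x = y) ->
  exists2 W, kernel_free W & forall y, exists2 w, W w & f w = y.
Proof.
move=> fsurj.
have [W [[Wlin Wker] Wmax]] := exists_maximal_kernel_free.
(* Maximality is not needed to know that 0 belongs to the subspace: adding it
   by hand is enough. *)
pose W0 w := W w \/ w = 0.
have W0lin a x z : W0 x -> W0 z -> W0 (a *: x + z).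
  move=> [Wx|->] [Wz|->].
  - by left; apply: Wlin.
  - have W00 : W 0 by have := Wlin (-1) x x Wx Wx; rewrite scaleN1r addNr.
    by left; apply: Wlin.
  - by left; rewrite scaler0 add0r.
  - by right; rewrite scaler0 add0r.
have W0ker x : W0 x -> f x = 0 -> x = 0.
  by move=> [Wx|->//]; apply: Wker.
exists W0 => // y.
have [e fe] := fsurj y.
have [//|Nw] := pselect (exists2 w, W0 w & f w = y); exfalso.
pose W' x := exists a w, W0 w /\ x = a *: e + w.
apply: (Wmax W').
  split=> [x Wx|W'W].
    by exists 0, x; split; [left | rewrite scale0r add0r].
  apply: Nw; exists e => //; left; apply: W'W.
  by exists 1, 0; split; [right | rewrite scale1r addr0].
split=> [a x z [b [w [Ww ->]]] [b' [w' [Ww' ->]]]|x [a [w [Ww ->]]]].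
  exists (a * b + b'), (a *: w + w'); split; first exact: W0lin.
  by rewrite scalerDr scalerA addrACA -scalerDl.
(* If a != 0 then the vector - a^-1 *: w has image y, which is excluded. *)
rewrite linearP /= fe => faw.
have [a0|aN0] := eqVneq a 0.
  by move: faw; rewrite a0 !scale0r !add0r; apply: W0ker.
case: Nw; exists (- a^-1 *: w).
  by rewrite -[_ *: w]addr0; apply: W0lin => //; right.
have -> : w = (a *: e + w) - a *: e by rewrite addrC addKr.
by rewrite linearZ linearB /= linearP /= fe faw sub0r linearZ /= fe
  scalerN scaleNr opprK scalerA mulVf // scale1r.
Qed.

Lemma linear_right_inverse : (forall y, exists x, f x = y) ->
  exists s : {linear V -> U}, forall y, f (s y) = y.
Proof.
move=> /kernel_complement[W [Wlin Wker] Wonto].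
have /choice[s sP] y : exists w, W w /\ f w = y.
  by have [w] := Wonto y; exists w.
have slin : linear s.
  move=> a x y.
  have [Wxy fxy] := sP (a *: x + y).
  have Wa : W (a *: s x + s y) by apply: Wlin; apply: (sP _).1.
  have /Wker d : W (-1 *: (a *: s x + s y) + s (a *: x + y)) by apply: Wlin.
  apply/eqP; rewrite -subr_eq0 [_ - _]addrC -scaleN1r d //.
  by rewrite linearP linearP /= fxy !(sP _).2 scaleN1r addNr.
pose sl : {linear V -> U} :=
  HB.pack s (GRing.isLinear.Build F V U *:%R s slin).
by exists sl => y; apply: (sP y).2.
Qed.

End LinearSection.

(** * Restricted Lie algebras with a derivation in characteristic 2 *)

Lemma linear_at0 (F : fieldType) (U V : lmodType F) (f : U -> V) :
  linear f -> f 0 = 0.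
Proof. by move=> /(_ (-1) 0 0); rewrite !scaleN1r !addNr. Qed.

Section LieLinearity.
Variables (F : fieldType) (L : lieType F).
Implicit Types x y z : L.

Lemma lieDr x y z : lie x (y + z) = lie x y + lie x z.
Proof. by have := lie_bilinear.1 x 1 y z; rewrite !scale1r. Qed.

Lemma lieDl x y z : lie (y + z) x = lie y x + lie z x.
Proof. by have := lie_bilinear.2 x 1 y z; rewrite /= !scale1r. Qed.

Lemma lieC x y : 2%N \in [pchar F] -> lie x y = lie y x.
Proof.
move=> char2; have := liexx (x + y).
rewrite lieDl !lieDr !liexx add0r addr0 => /eqP; rewrite addr_eq0 => /eqP ->.
by rewrite -scaleN1r oppr_pchar2 // scale1r.
Qed.

End LieLinearity.

Section DerLinearity.
Variables (F : fieldType) (L : resLieDerType F).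

Lemma derD (x y : L) : der (x + y) = der x + der y.
Proof. by have := der_linear 1 x y; rewrite !scale1r. Qed.

End DerLinearity.

Section Char2Module.
Variables (F : fieldType) (V : lmodType F).
Hypothesis char2 : 2%N \in [pchar F].
Implicit Types x y : V.

Lemma addxx_char2 x : x + x = 0.
Proof. by rewrite -mulr2n -scaler_nat (pcharf0 char2) scale0r. Qed.

Lemma oppx_char2 x : - x = x.
Proof. by apply/eqP; rewrite eq_sym -addr_eq0 addxx_char2. Qed.

Lemma addxK_char2 x y : x + y + y = x.
Proof. by rewrite -addrA addxx_char2 addr0. Qed.

Lemma addx_eq0_char2 x y : x + y = 0 -> x = y.
Proof. by move/eqP; rewrite addr_eq0 oppx_char2 => /eqP. Qed.

End Char2Module.


(** * Cocycles of sections *)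

Section SectionCocycle.
Variables (F : fieldType) (g h : resLieDerType F).
Hypothesis char2 : 2%N \in [pchar F].
Hypothesis h_abelian : strongly_abelian h.
Variable E : central_ext g h.
Implicit Types (s : {linear g -> E}) (c : precochain g h) (k : {linear g -> h}).

Lemma ext_section_exists : exists s, is_section s.
Proof. exact: linear_right_inverse (ext_proj_surj E). Qed.

Lemma lie_ext_inc (e : E) a : lie e (ext_inc E a) = 0.
Proof. by rewrite lieC // ext_central. Qed.

Lemma lie_addl_inc (e e' : E) a : lie (e + ext_inc E a) e' = lie e e'.
Proof. by rewrite lieDl ext_central addr0. Qed.

Lemma lie_addr_inc (e e' : E) a : lie e (e' + ext_inc E a) = lie e e'.
Proof. by rewrite lieDr lie_ext_inc addr0. Qed.

Lemma pow2_ext_inc a : pow2 (ext_inc E a) = 0.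
Proof.
by have [_ <- _] := ext_inc_morph E; rewrite h_abelian.2 linear0.
Qed.

Lemma pow2_add_inc (e : E) a : pow2 (e + ext_inc E a) = pow2 e.
Proof. by rewrite pow2D pow2_ext_inc lie_ext_inc !addr0. Qed.

Lemma der_ext_inc a : der (ext_inc E a) = ext_inc E (der a).
Proof. by have [_ _ <-] := ext_inc_morph E. Qed.

Lemma section_cochain_exists s : is_section s -> exists c, section_cochain s c.
Proof.
move=> sP; have [pl pp pd] := ext_proj_morph E.
have /choice[psi psiP] (u : g * g) : exists a,
    ext_inc E a = lie (s u.1) (s u.2) + s (lie u.1 u.2).
  by apply/ext_exact; rewrite linearD /= pl !sP addxx_char2.
have /choice[vs vsP] x : exists a, ext_inc E a = pow2 (s x) + s (pow2 x).
  by apply/ext_exact; rewrite linearD /= pp !sP addxx_char2.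
have /choice[tau tauP] x : exists a, ext_inc E a = der (s x) + s (der x).
  by apply/ext_exact; rewrite linearD /= pd !sP addxx_char2.
exists (fun x y => psi (x, y), vs, tau).
by split=> // x y; apply: (psiP (x, y)).
Qed.

Lemma section_cochain_unique s c c' :
  section_cochain s c -> section_cochain s c' -> c = c'.
Proof.
case: c c' => [[p v] t] [[p' v'] t'] [cp cv ct] [cp' cv' ct'].
have iI := @ext_inc_inj _ _ _ E.
congr (_, _, _); last by apply/funext => x; apply: iI; rewrite ct ct'.
  by apply/funext => x; apply/funext => y; apply: iI; rewrite cp cp'.
by apply/funext => x; apply: iI; rewrite cv cv'.
Qed.

(** The cocycle identities express, inside the extension, the axioms satisfied
    by the lifts [s x]; the values of the cochain are central, so they disappear
    from brackets. *)
Lemma section_cochain_cocycle s c : section_cochain s c -> is_2cocycle c.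
Proof.
case: c => [[psi vs] tau] [ip iv it].
have iI := @ext_inc_inj _ _ _ E.
have sl x y : s (lie x y) = lie (s x) (s y) + ext_inc E (psi x y).
  by rewrite ip addrA addxx_char2 // add0r.
have sp x : s (pow2 x) = pow2 (s x) + ext_inc E (vs x).
  by rewrite iv addrA addxx_char2 // add0r.
have sd x : s (der x) = der (s x) + ext_inc E (tau x).
  by rewrite it addrA addxx_char2 // add0r.
split; split.
- split; last by move=> x; apply: iI; rewrite ip !liexx !linear0 addr0.
  split=> x a y z; apply: iI; rewrite linearP /= !ip.
    rewrite (lie_bilinear.1 x) !linearP /= (lie_bilinear.1 (s x)).
    by rewrite scalerDr addrACA.
  rewrite linearP /= (lie_bilinear.2 x a y z) (lie_bilinear.2 (s x)) /=.
  by rewrite linearP scalerDr addrACA.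
- move=> a x; apply: iI.
  by rewrite linearZ /= !iv linearZ /= !pow2Z linearZ scalerDr.
- move=> x y; apply: iI.
  rewrite !linearD /= !iv ip linearD /= !pow2D !linearD /=.
  by rewrite addrACA; congr (_ + _); rewrite addrACA.
- move=> a x y; apply: iI.
  rewrite linearP /= !it linearP /= !(der_linear a x y) der_linear.
  by rewrite linearP scalerDr addrACA.
- move=> x y z; apply: iI; rewrite !linearD linear0 /= !ip.
  rewrite [s (lie y z)]sl [s (lie z x)]sl [s (lie x y)]sl !lie_addr_inc.
  rewrite (AC (2*2*2) ((1*3*5)*(2*4*6))) /=.
  by rewrite lie_jacobi -!linearD lie_jacobi linear0 addr0.
- move=> x y; apply: iI; rewrite linearD linear0 /= !ip.
  rewrite [s (pow2 x)]sp [s (lie x y)]sl !lie_addl_inc !lie_pow2.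
  by rewrite (lieC (lie (s x) (s y))) // (lieC (lie x y)) // addxx_char2.
(* Once expanded in [E], each of the last two sums contains every term twice. *)
- move=> x y; apply: iI; rewrite !linearD linear0 /= -der_ext_inc.
  rewrite it ip [in s (der _)]der_lie !ip !sd.
  rewrite lie_addl_inc lie_addr_inc derD !linearD /= [der (lie _ _)]der_lie.
  rewrite (AC ((1*2)*3*2*2) ((1*6)*(2*8)*(3*10)*(4*7)*(5*9))) /=.
  by rewrite !addxx_char2 // !addr0.
- move=> x; apply: iI; rewrite !linearD linear0 /= -der_ext_inc.
  rewrite it iv ip [s (der x)]sd lie_addr_inc derD !der_pow2.
  rewrite (AC (2*2*2) ((1*4)*(2*6)*(3*5))) /=.
  by rewrite !addxx_char2 // !addr0.
Qed.

(** Moving a section by [k : g -> h] moves its cocycle by the coboundary of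
    [k]. *)
Lemma section_cochain_shift s s' c k :
  (forall x, s' x = s x + ext_inc E (k x)) -> section_cochain s c ->
  section_cochain s' (c + coboundary k).
Proof.
case: c => [[psi vs] tau] s'E [ip iv it]; split=> [x y|x|x].
- rewrite [LHS](_ : _ = ext_inc E (psi x y + k (lie x y))) //.
  by rewrite linearD /= ip !s'E lie_addl_inc lie_addr_inc addrA.
- rewrite [LHS](_ : _ = ext_inc E (vs x + k (pow2 x))) //.
  by rewrite linearD /= iv !s'E pow2_add_inc addrA.
- rewrite [LHS](_ : _ = ext_inc E (tau x + (der (k x) + k (der x)))) //.
  by rewrite !linearD /= it !s'E derD der_ext_inc addrACA.
Qed.

Lemma section_shift s k : is_section s ->
  exists s' : {linear g -> E},
    is_section s' /\ forall x, s' x = s x + ext_inc E (k x).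
Proof.
move=> sP.
exists (GRing.Linear.clone _ _ _ _ (s \+ (ext_inc E \o k)) _); split=> // x /=.
rewrite linearD /= sP.
suff -> : ext_proj E (ext_inc E (k x)) = 0 by rewrite addr0.
by apply/ext_exact; exists (k x).
Qed.

Lemma sections_differ s s' : is_section s -> is_section s' ->
  exists k : {linear g -> h}, forall x, s' x = s x + ext_inc E (k x).
Proof.
move=> sP s'P.
have /choice[k kP] x : exists a, ext_inc E a = s' x - s x.
  by apply/ext_exact; rewrite linearB /= sP s'P subrr.
have klin : linear k.
  move=> a x y; apply: (@ext_inc_inj _ _ _ E).
  by rewrite linearP /= !kP (linearP s) (linearP s') /= opprD addrACA scalerBr.
pose kl : {linear g -> h} :=
  HB.pack k (GRing.isLinear.Build F g h *:%R k klin).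
by exists kl => x; rewrite /= kP addrC subrK.
Qed.

Lemma section_cochain_cohomologous s s' c c' : is_section s -> is_section s' ->
  section_cochain s c -> section_cochain s' c' ->
  exists k : {linear g -> h}, c' = c + coboundary k.
Proof.
move=> sP s'P cP c'P; have [k s'E] := sections_differ sP s'P.
by exists k; apply: section_cochain_unique c'P (section_cochain_shift s'E cP).
Qed.

End SectionCocycle.

(** Composing a section with an isomorphism of extensions does not change its
    cochain. *)
Lemma ext_iso_section_cochain (F : fieldType) (g h : resLieDerType F)
    (E1 E2 : central_ext g h) (s1 : {linear g -> E1}) c :
  ext_iso E1 E2 -> is_section s1 -> section_cochain s1 c ->
  exists2 s2 : {linear g -> E2}, is_section s2 & section_cochain s2 c.
Proof.
case: c => [[psi vs] tau] [f [[fl fp fd] fi fpr]] s1P [ip iv it].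
exists (GRing.Linear.clone _ _ _ _ (f \o s1) _) => [x|/=].
  by rewrite /= fpr s1P.
split=> [x y|x|x] /=.
- by rewrite -fi ip linearD /= fl.
- by rewrite -fi iv linearD /= fp.
- by rewrite -fi it linearD /= fd.
Qed.

(** * The extension defined by a cocycle *)

Section CocycleExtension.
Variables (F : fieldType) (g h : resLieDerType F).

(** The three components [psi], [vs] and [tau] of a cocycle. *)
Definition cocycle_bracket (c : Z2 g h) := (Z2val c).1.1.
Definition cocycle_square (c : Z2 g h) := (Z2val c).1.2.
Definition cocycle_der (c : Z2 g h) := (Z2val c).2.

Lemma Z2valE (c : Z2 g h) :
  Z2val c = (cocycle_bracket c, cocycle_square c, cocycle_der c).
Proof. by rewrite -!surjective_pairing. Qed.

Lemma Z2P (c : Z2 g h) :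
  is_2cocycle (cocycle_bracket c, cocycle_square c, cocycle_der c).
Proof. by case: c => [[[psi vs] tau] cP]; apply/asboolP. Qed.

(** The module [h * g], to be equipped with the operations twisted by the
    cocycle [c]; the characteristic is a parameter of the type because the
    proofs of some axioms of the twisted operations use it. *)
Definition twisted_sum (_ : 2%N \in [pchar F]) (_ : Z2 g h) : Type :=
  (h * g)%type.

Variables (char2 : 2%N \in [pchar F]) (c : Z2 g h).
Local Notation E := (twisted_sum char2 c).
Local Notation psi := (cocycle_bracket c).
Local Notation vs := (cocycle_square c).
Local Notation tau := (cocycle_der c).

HB.instance Definition _ := GRing.Lmodule.on E.

(** The operations of [E] read on pairs, the second component being that of [g]
    and the first one carrying the cocycle; [der u.1] appears because the
    derivation of [h], unlike its bracket and square, need not vanish. *)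
Definition twisted_lie (u v : E) : E := (psi u.2 v.2, lie u.2 v.2).
Definition twisted_pow2 (u : E) : E := (vs u.2, pow2 u.2).
Definition twisted_der (u : E) : E := (der u.1 + tau u.2, der u.2).

Lemma twisted_lie_bilinear : bilinear_map twisted_lie.
Proof.
have [[[[pl pr] _] _ _ _] _] := Z2P c.
split=> u a v w; congr (_, _).
- exact: pl.
- exact: lie_bilinear.1.
- exact: (pr u.2 a v.2 w.2).
- exact: (lie_bilinear.2 u.2 a v.2 w.2).
Qed.

Lemma twisted_liexx u : twisted_lie u u = 0.
Proof.
have [[[_ palt] _ _ _] _] := Z2P c.
by rewrite /twisted_lie palt liexx.
Qed.

Lemma twisted_lie_jacobi u v w :
  twisted_lie u (twisted_lie v w) + twisted_lie v (twisted_lie w u) +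
  twisted_lie w (twisted_lie u v) = 0.
Proof.
have [_ [jac _ _ _]] := Z2P c.
by congr (_, _); [apply: jac | apply: lie_jacobi].
Qed.

HB.instance Definition _ := isLieAlgebra.Build F E
  twisted_lie_bilinear twisted_liexx twisted_lie_jacobi.

(** Read off the first component of the antisymmetry of the twisted bracket. *)
Lemma cocycle_bracketC x y : psi x y = psi y x.
Proof.
have := @lieC F E (0, x) (0, y) char2.
by case.
Qed.

Lemma twisted_lie_pow2 (u v : E) : lie (twisted_pow2 u) v = lie u (lie u v).
Proof.
have [_ [_ p2 _ _]] := Z2P c; congr (_, _); last exact: lie_pow2.
by rewrite /= (addx_eq0_char2 char2 (p2 _ _)) cocycle_bracketC.
Qed.

Lemma twisted_pow2Z (a : F) (u : E) :
  twisted_pow2 (a *: u) = a ^+ 2 *: twisted_pow2 u.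
Proof.
have [[_ vZ _ _] _] := Z2P c.
by congr (_, _); [apply: vZ | apply: pow2Z].
Qed.

Lemma twisted_pow2D (u v : E) :
  twisted_pow2 (u + v) = twisted_pow2 u + twisted_pow2 v + lie u v.
Proof.
have [[_ _ vD _] _] := Z2P c.
by congr (_, _); [apply: vD | apply: pow2D].
Qed.

HB.instance Definition _ := isRestricted2.Build F E
  twisted_lie_pow2 twisted_pow2Z twisted_pow2D.

Lemma twisted_der_linear : linear twisted_der.
Proof.
have [[_ _ _ tl] _] := Z2P c.
move=> a u v; congr (_, _); last exact: der_linear.
by rewrite /= der_linear tl scalerDr addrACA.
Qed.

Lemma twisted_der_lie (u v : E) :
  twisted_der (lie u v) = lie (twisted_der u) v + lie u (twisted_der v).
Proof.
have [_ [_ _ tl _]] := Z2P c; congr (_, _); last exact: der_lie.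
apply: (addx_eq0_char2 char2).
by rewrite -(tl u.2 v.2) /= (addrC (der _)) addrA.
Qed.

Lemma twisted_der_pow2 (u : E) : twisted_der (pow2 u) = lie u (twisted_der u).
Proof.
have [_ [_ _ _ tp]] := Z2P c; congr (_, _); last exact: der_pow2.
by apply: (addx_eq0_char2 char2); rewrite -(tp u.2) /= (addrC (der _)).
Qed.

HB.instance Definition _ := hasRestrictedDerivation.Build F E
  twisted_der_linear twisted_der_lie twisted_der_pow2.

Definition twisted_inc (a : h) : E := (a, 0).
Definition twisted_proj (u : E) : g := u.2.
Definition twisted_section (x : g) : E := (0, x).

Lemma twisted_inc_linear : linear twisted_inc.
Proof. by move=> a x y; congr (_, _); rewrite /= scaler0 addr0. Qed.
HB.instance Definition _ := GRing.isLinear.Build F h E *:%R twisted_inc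
  twisted_inc_linear.

Lemma twisted_proj_linear : linear twisted_proj.
Proof. by []. Qed.
HB.instance Definition _ := GRing.isLinear.Build F E g *:%R twisted_proj
  twisted_proj_linear.

Lemma twisted_section_linear : linear twisted_section.
Proof. by move=> a x y; congr (_, _); rewrite /= scaler0 addr0. Qed.
HB.instance Definition _ := GRing.isLinear.Build F g E *:%R twisted_section
  twisted_section_linear.

Hypothesis h_abelian : strongly_abelian h.

Lemma twisted_inc_morph : pair_morphism twisted_inc.
Proof.
have [[[_ palt] vZ _ tl] _] := Z2P c.
have vs0 : vs 0 = 0 by have := vZ 0 0; rewrite scale0r expr0n /= scale0r.
split=> [x y|x|x].
- by rewrite h_abelian.1; congr (_, _); rewrite ?palt ?liexx.
- rewrite h_abelian.2; congr (_, _); rewrite /= ?vs0 //.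
  by have := pow2Z 0 (0 : g); rewrite scale0r expr0n /= scale0r.
- congr (_, _); rewrite /= ?(linear_at0 tl) ?addr0 //.
  by rewrite (linear_at0 der_linear).
Qed.

Lemma twisted_proj_morph : pair_morphism twisted_proj.
Proof. by []. Qed.

Lemma twisted_inc_inj : injective twisted_inc.
Proof. by move=> a b []. Qed.

Lemma twisted_exact (e : E) :
  twisted_proj e = 0 <-> exists a, twisted_inc a = e.
Proof. by split=> [|[a <-] //]; case: e => a x /= ->; exists a. Qed.

Lemma twisted_proj_surj x : exists e, twisted_proj e = x.
Proof. by exists (twisted_section x). Qed.

Lemma twisted_central a (e : E) : lie (twisted_inc a) e = 0.
Proof.
have [[[[_ pr] _] _ _ _] _] := Z2P c.
by congr (_, _); [apply: (linear_at0 (pr e.2)) |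
  apply: (linear_at0 (lie_bilinear.2 e.2))].
Qed.

(** The pairs [(a, x)] as an extension of [g], the projection to [x], by [h],
    the inclusion of the pairs [(a, 0)]. *)
Definition twisted_ext : central_ext g h :=
  CentralExt twisted_inc_morph twisted_proj_morph twisted_inc_inj twisted_exact
    twisted_proj_surj twisted_central.

Lemma twisted_is_section : @is_section _ _ _ twisted_ext twisted_section.
Proof. by []. Qed.

Lemma twisted_section_cochain :
  @section_cochain _ _ _ twisted_ext twisted_section (Z2val c).
Proof.
rewrite Z2valE.
split=> [x y|x|x]; congr (_, _); rewrite /= ?addxx_char2 //.
- by rewrite addr0.
- by rewrite addr0.
- by rewrite (linear_at0 der_linear) add0r addr0.
Qed.

(** Every extension in which [c] is the cocycle of a section [s] is the
    twisted sum, through [(a, x) |-> a + s x]. *)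
Lemma twisted_ext_iso (E' : central_ext g h) (s : {linear g -> E'}) :
  is_section s -> section_cochain s (Z2val c) -> ext_iso twisted_ext E'.
Proof.
rewrite Z2valE => sP [ip iv it].
pose f (u : E) : E' := ext_inc E' u.1 + s u.2.
have flin : linear f.
  by move=> a u v; rewrite /f !linearP /= scalerDr addrACA.
pose fl : {linear E -> E'} :=
  HB.pack f (GRing.isLinear.Build F E E' *:%R f flin).
exists fl; split=> [|a|e].
- split=> [u v|u|u]; rewrite /= /f.
  + rewrite ip addxK_char2 // ![ext_inc E' _ + s _]addrC.
    by rewrite lie_addl_inc lie_addr_inc.
  + by rewrite iv addxK_char2 // [ext_inc E' _ + s _]addrC pow2_add_inc.
  + by rewrite linearD /= it derD der_ext_inc !addrA addxK_char2.
- by rewrite /= /f linear0 addr0.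
- rewrite /= /f linearD /= sP.
  suff -> : ext_proj E' (ext_inc E' e.1) = 0 by rewrite add0r.
  by apply/ext_exact; exists e.1.
Qed.

End CocycleExtension.

(** * Classification *)

Lemma class_of_ext_eq (F : fieldType) (g h : resLieDerType F)
    (E1 E2 : central_ext g h) :
  class_of_ext E1 = class_of_ext E2 <-> ext_iso E1 E2.
Proof.
split=> [/(congr1 (fun C => sval C E2)) /= -> |iso12].
  exact: ext_iso_refl.
apply: eq_exist; apply/funext => E; apply/propext; split.
- exact: ext_iso_trans (ext_iso_sym iso12).
- exact: ext_iso_trans iso12.
Qed.

Lemma H2_class_eq (F : fieldType) (g h : resLieDerType F) (c d : Z2 g h) :
  H2_class c = H2_class d <->
  exists k : {linear g -> h}, Z2val c = Z2val d + coboundary k.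
Proof.
rewrite /H2_class; split=> [/eqP|[k ck]].
  rewrite -Quotient.idealrBE => /asboolP[k /= dk]; exists k.
  by rewrite -dk addrC subrK.
apply/eqP; rewrite -Quotient.idealrBE; apply/asboolP; exists k.
by rewrite raddfB /= ck addrAC subrr add0r.
Qed.

Theorem theorem5p7 (F : fieldType) (char2 : 2%N \in [pchar F])
    (g h : resLieDerType F) (h_abelian : strongly_abelian h) :
  (forall E : central_ext g h, exists s : {linear g -> E}, is_section s) /\
  (forall (E : central_ext g h) (s : {linear g -> E}), is_section s ->
     exists! c : Z2 g h, section_cochain s (Z2val c)) /\
  (exists2 Phi : ext_class g h -> H2 g h,
     forall (E : central_ext g h) (s : {linear g -> E}) (c : Z2 g h),
       is_section s -> section_cochain s (Z2val c) ->
       Phi (class_of_ext E) = H2_class c &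
     bijective Phi).
Proof.
have Z2ex (E : central_ext g h) (s : {linear g -> E}) :
    is_section s -> exists c : Z2 g h, section_cochain s (Z2val c).
  move=> sP; have [c cP] := section_cochain_exists char2 sP.
  have /asboolP cZ := section_cochain_cocycle char2 cP.
  by exists (MkZ2 cZ).
split; first exact: ext_section_exists.
split=> [E s sP|].
  have [c cP] := Z2ex E s sP; exists c; split=> // c' c'P.
  by apply: val_inj; apply: section_cochain_unique cP c'P.
(* A representative extension, section and cocycle for each class. *)
have /choice[Phi PhiP] (C : ext_class g h) : exists u : H2 g h,
    exists E : central_ext g h, exists s : {linear g -> E}, exists c : Z2 g h,
    [/\ C = class_of_ext E, is_section s, section_cochain s (Z2val c) &
        u = H2_class c].
  case: C => C [E CE].
  have [s sP] := ext_section_exists E; have [c cP] := Z2ex E s sP.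
  by exists (H2_class c), E, s, c; split=> //; apply: eq_exist.
have PhiE (E : central_ext g h) (s : {linear g -> E}) (c : Z2 g h) :
    is_section s -> section_cochain s (Z2val c) ->
    Phi (class_of_ext E) = H2_class c.
  move=> sP cP.
  have [E0 [s0 [c0 [/class_of_ext_eq/ext_iso_sym iso s0P c0P ->]]]] :=
    PhiP (class_of_ext E).
  have [s1 s1P c1P] := ext_iso_section_cochain iso s0P c0P.
  exact/H2_class_eq/(section_cochain_cohomologous char2 h_abelian sP s1P).
exists Phi => //.
exists (fun u : H2 g h => class_of_ext (twisted_ext char2 (repr u) h_abelian)).
- move=> C; have [E [s [c [-> sP cP ->]]]] := PhiP C.
  have /H2_class_eq[k dE] : H2_class (repr (H2_class c)) = H2_class c.
    exact: reprK.
  have [s' [s'P s'E]] := section_shift k sP.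
  apply/class_of_ext_eq/(twisted_ext_iso char2 h_abelian s'P).
  by rewrite dE; apply: (section_cochain_shift char2 h_abelian s'E cP).
- move=> u; rewrite -[RHS]reprK; apply: PhiE (twisted_is_section _ _ _) _.
  exact: twisted_section_cochain.
Qed.
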